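(* Let $m,p\in\mathbb{N}=\{0,1,2,\dots\}$ and $\mathbf{x},\mathbf{y}\in\mathbb{R}^2$. If $p\geq|\mathbf{y}|$, then $$\left|R^J_{m,p}(\mathbf{x},\mathbf{y})\right|\leq\frac{4}{\Gamma(p+2)}\left(\frac{|\mathbf{y}|}{2}\right)^{p+1}.$$
   Context: $J_n$ is the Bessel function of the first kind of integer order $n$, and $\theta_{\mathbf{x}}$ denotes the polar angle of $\mathbf{x}\in\mathbb{R}^2$. For $m\in\mathbb{Z}$ and $p\in\mathbb{N}$, $$R^{J}_{m,p}(\mathbf{x},\mathbf{y})=\left(\sum_{n=p+1}^\infty+\sum_{n=-\infty}^{-p-1}\right)J_{m+n}(|\mathbf{x}|)\,e^{\pm\mathrm{i}(m+n)\theta_\mathbf{x}}\,J_n(|\mathbf{y}|)\,e^{\mp\mathrm{i}n\theta_\mathbf{y}},$$ where either the upper signs are taken throughout or the lower signs are taken throughout; the statement holds for both choices. This is the truncation error of Graf's addition theorem $J_m(|\mathbf{x}-\mathbf{y}|)e^{\pm\mathrm{i}m\theta_{\mathbf{x}-\mathbf{y}}}=\sum_{n=-\infty}^{\infty}J_{m+n}(|\mathbf{x}|)e^{\pm\mathrm{i}(m+n)\theta_\mathbf{x}}J_n(|\mathbf{y}|)e^{\mp\mathrm{i}n\theta_\mathbf{y}}$ truncated to $|n|\le p$. *)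

(* Defs.v *)
From Stdlib Require Import Reals ZArith Lra.
From Coquelicot Require Import Coquelicot.
Open Scope R_scope.

Definition vnorm (v : R * R) : R := sqrt (fst v ^ 2 + snd v ^ 2).

(* Every real is a polar angle of the origin; elsewhere the polar angle is
   determined up to a multiple of 2 PI. *)
Definition is_polar_angle (v : R * R) (t : R) : Prop :=
  fst v = vnorm v * cos t /\ snd v = vnorm v * sin t.

Definition cis (t : R) : C := (cos t, sin t).

(* J_n(x) = sum_k (-1)^k / (k! (n+k)!) (x/2)^(2k+n) for n >= 0. *)
Definition BesselJ_nat (n : nat) (x : R) : R :=
  Series (fun k : nat =>
    (-1) ^ k / (INR (fact k) * INR (fact (n + k))) * (x / 2) ^ (2 * k + n)).

(* J_(-n) = (-1)^n J_n. *)
Definition BesselJ (n : Z) (x : R) : R :=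
  if (n <? 0)%Z
  then (-1) ^ Z.abs_nat n * BesselJ_nat (Z.abs_nat n) x
  else BesselJ_nat (Z.abs_nat n) x.

(* Euler's integral, which defines Gamma for s > 0. *)
Definition Gamma (s : R) : R :=
  RInt_gen (fun t => Rpower t (s - 1) * exp (- t))
    (at_right 0) (Rbar_locally p_infty).

(* Coquelicot's Series is real-valued only. *)
Definition CSeries (a : nat -> C) : C :=
  (Series (fun n => fst (a n)), Series (fun n => snd (a n))).

(* [s] is the sign: 1 for the upper signs, -1 for the lower ones;
   [theta v] is the polar angle of [v]. *)
Definition graf_term (theta : R * R -> R) (s : R) (m : Z) (x y : R * R)
    (n : Z) : C :=
  (RtoC (BesselJ (m + n) (vnorm x)) * cis (s * IZR (m + n) * theta x)
   * RtoC (BesselJ n (vnorm y)) * cis (- s * IZR n * theta y))%C.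

Definition RJ (theta : R * R -> R) (s : R) (m : Z) (p : nat)
    (x y : R * R) : C :=
  (CSeries (fun k => graf_term theta s m x y (Z.of_nat (p + 1 + k)))
   + CSeries (fun k => graf_term theta s m x y (- Z.of_nat (p + 1 + k))))%C.

Lemma CSeries_unique (a : nat -> C) (l : C) :
  is_series (V := C_R_NormedModule) a l -> CSeries a = l.
Proof.
intros H; destruct l as [l1 l2]; unfold CSeries; f_equal;
  apply is_series_unique.
- apply filterlim_ext with (fun n => fst (sum_n (G := C_R_NormedModule) a n)).
  + intros n; induction n as [|n IH].
    * now rewrite !sum_O.
    * now rewrite !sum_Sn, <- IH.
  + apply (filterlim_comp _ _ _ _ _ _ _ _ H).
    intros P [e He]; exists e; intros [z1 z2] [Hz _]; exact (He z1 Hz).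
- apply filterlim_ext with (fun n => snd (sum_n (G := C_R_NormedModule) a n)).
  + intros n; induction n as [|n IH].
    * now rewrite !sum_O.
    * now rewrite !sum_Sn, <- IH.
  + apply (filterlim_comp _ _ _ _ _ _ _ _ H).
    intros P [e He]; exists e; intros [z1 z2] [_ Hz]; exact (He z2 Hz).
Qed.

Lemma polar_angle_exists :
  exists theta : R * R -> R, forall v, is_polar_angle v (theta v).
Proof.
exists (fun v => if Rle_dec 0 (snd v) then acos (fst v / vnorm v)
                 else - acos (fst v / vnorm v)).
intros [a b]; unfold is_polar_angle, vnorm; simpl fst; simpl snd.
set (r := sqrt (a ^ 2 + b ^ 2)).
assert (Hr : 0 <= r) by apply sqrt_pos.
assert (Hr2 : r * r = a ^ 2 + b ^ 2) by (apply sqrt_sqrt; nra).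
destruct (Req_dec r 0) as [Hr0|Hr0].
{ rewrite Hr0 in *; split; nra. }
assert (Hc : -1 <= a / r <= 1).
{ split; [apply Rle_div_r|apply Rle_div_l]; nra. }
assert (Hs : r * sqrt (1 - (a / r)²) = Rabs b).
{ rewrite <- (sqrt_Rsqr r) at 1 by exact Hr.
  rewrite <- sqrt_mult_alt by apply Rle_0_sqr.
  rewrite <- sqrt_Rsqr_abs; f_equal; unfold Rsqr.
  replace (r * r * (1 - a / r * (a / r))) with (r * r - a ^ 2)
    by (field; exact Hr0).
  rewrite Hr2; ring. }
destruct (Rle_dec 0 b) as [Hb|Hb].
- rewrite cos_acos, sin_acos, Hs by exact Hc; split.
  + field; exact Hr0.
  + symmetry; apply Rabs_pos_eq; exact Hb.
- rewrite cos_neg, sin_neg, cos_acos, sin_acos by exact Hc; split.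
  + field; exact Hr0.
  + rewrite Ropp_mult_distr_r_reverse, Hs, Rabs_left by lra; ring.
Qed.

(* Main.v *)
(** The reduced Bessel functions [j_n(u) = sum_k (-1)^k u^k / (k! (n+k)!)] satisfy
    [J_n(2t) = t^n j_n(t^2)].  Since [2 J_n' = J_(n-1) - J_(n+1)], the derivative of
    [J_0^2 + 2 (J_1^2 + ... + J_N^2)] telescopes to a multiple of [J_N J_(N+1)], which tends
    to 0 as [N] grows; hence [J_0^2 + 2 sum_n J_n^2 = 1] and [|J_n| <= 1].  From [|j_0| <= 1],
    integrating [(u^n j_n)' = u^(n-1) j_(n-1)] gives [|j_n| <= 1/n!] on [u >= 0], that is
    [|J_n(r)| <= (r/2)^n / n!].  So the [k]-th term of either tail of Graf's series is at most
    [(r/2)^(p+1+k) / (p+1+k)! <= 2^(-k) (r/2)^(p+1) / (p+1)!] when [r <= p]. *)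

Require Import Defs.
From Stdlib Require Import Reals ZArith Lra Lia.
From Coquelicot Require Import Coquelicot.
Open Scope R_scope.

(** * Reduced Bessel functions: convergence, derivative, recurrence *)

Definition rbessel_coef (n k : nat) : R :=
  (-1) ^ k / (INR (fact k) * INR (fact (n + k))).

Definition rbessel (n : nat) (u : R) : R := PSeries (rbessel_coef n) u.

Lemma INR_fact_S (n : nat) : INR (fact (S n)) = (INR n + 1) * INR (fact n).
Proof. now rewrite fact_simpl, mult_INR, S_INR. Qed.

Lemma pow_m1_neq_0 (k : nat) : (-1) ^ k <> 0.
Proof. apply pow_nonzero; lra. Qed.

Lemma Rabs_pow_m1 (k : nat) : Rabs ((-1) ^ k) = 1.
Proof. apply pow_1_abs. Qed.

Lemma rbessel_coef_neq_0 (n k : nat) : rbessel_coef n k <> 0.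
Proof.
unfold rbessel_coef, Rdiv; apply Rmult_integral_contrapositive_currified.
- apply pow_m1_neq_0.
- apply Rinv_neq_0_compat, Rmult_integral_contrapositive_currified;
    apply INR_fact_neq_0.
Qed.

(** Ratio test: consecutive coefficients have quotient [-1/((k+1)(n+k+1))], which is at most
    [1/(k+1)] in absolute value. *)
Lemma CV_radius_rbessel (n : nat) : CV_radius (rbessel_coef n) = p_infty.
Proof.
apply CV_radius_infinite_DAlembert.
- apply rbessel_coef_neq_0.
- apply is_lim_seq_le_le with (u := fun _ => 0) (w := fun k => / INR (S k)).
  + intros k; split; [apply Rabs_pos|].
    assert (E : rbessel_coef n (S k) / rbessel_coef n k
                = - (/ INR (S k) * / (INR (n + k) + 1))).
    { unfold rbessel_coef.
      rewrite Nat.add_succ_r, !INR_fact_S, S_INR; simpl.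
      pose proof (pos_INR k); pose proof (pos_INR (n + k)).
      field; repeat split; try apply INR_fact_neq_0; try lra.
      apply pow_m1_neq_0. }
    rewrite E, Rabs_Ropp, S_INR.
    pose proof (pos_INR k); pose proof (pos_INR (n + k)).
    assert (0 < / (INR k + 1)) by (apply Rinv_0_lt_compat; lra).
    assert (0 < / (INR (n + k) + 1)) by (apply Rinv_0_lt_compat; lra).
    assert (/ (INR (n + k) + 1) <= 1)
      by (rewrite <- Rinv_1; apply Rinv_le_contravar; lra).
    rewrite Rabs_pos_eq by nra; nra.
  + apply is_lim_seq_const.
  + apply (is_lim_seq_incr_1 (fun k => / INR k)).
    apply (is_lim_seq_inv INR p_infty); [apply is_lim_seq_INR|easy].
Qed.

Lemma ex_pseries_rbessel (n : nat) (u : R) : ex_pseries (rbessel_coef n) u.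
Proof. apply CV_radius_inside; now rewrite CV_radius_rbessel. Qed.

(** Termwise differentiation: the factor [k+1] cancels against [(k+1)!], which leaves the
    coefficients of order [n+1] with the opposite sign. *)
Lemma is_derive_rbessel (n : nat) (u : R) :
  is_derive (rbessel n) u (- rbessel (S n) u).
Proof.
unfold rbessel; rewrite <- PSeries_opp.
rewrite (PSeries_ext _ (PS_derive (rbessel_coef n))).
- apply is_derive_PSeries; now rewrite CV_radius_rbessel.
- intros k; unfold PS_derive, PS_opp, rbessel_coef, opp; simpl opp.
  rewrite Nat.add_succ_r, Nat.add_succ_l, !INR_fact_S, S_INR; simpl.
  pose proof (pos_INR k); pose proof (pos_INR (n + k)).
  field; repeat split; try apply INR_fact_neq_0; lra.
Qed.

(** Reduced form of the three-term recurrence [J_n(2t) + J_(n+2)(2t) = ((n+1)/t) J_(n+1)(2t)],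
    checked coefficient by coefficient. *)
Lemma rbessel_rec (n : nat) (u : R) :
  (INR n + 1) * rbessel (S n) u = rbessel n u + u * rbessel (S (S n)) u.
Proof.
unfold rbessel; rewrite <- PSeries_incr_1, <- PSeries_scal, <- PSeries_plus.
2: apply ex_pseries_rbessel.
2: apply ex_pseries_incr_1, ex_pseries_rbessel.
apply PSeries_ext; intros [|k].
- change ((INR n + 1) * rbessel_coef (S n) 0 = rbessel_coef n 0 + 0).
  unfold rbessel_coef; rewrite !Nat.add_0_r, INR_fact_S; simpl.
  pose proof (pos_INR n).
  field; repeat split; try apply INR_fact_neq_0; lra.
- change ((INR n + 1) * rbessel_coef (S n) (S k)
          = rbessel_coef n (S k) + rbessel_coef (S (S n)) k).
  unfold rbessel_coef.
  replace (S n + S k)%nat with (S (S (n + k))) by lia.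
  replace (n + S k)%nat with (S (n + k)) by lia.
  replace (S (S n) + k)%nat with (S (S (n + k))) by lia.
  rewrite !INR_fact_S, S_INR, plus_INR; simpl pow.
  pose proof (pos_INR k); pose proof (pos_INR n).
  field; repeat split; try apply INR_fact_neq_0; lra.
Qed.

Lemma BesselJ_nat_rbessel (n : nat) (x : R) :
  BesselJ_nat n x = (x / 2) ^ n * rbessel n ((x / 2) ^ 2).
Proof.
unfold BesselJ_nat, rbessel, PSeries.
rewrite <- Series_scal_l; apply Series_ext; intros k.
unfold rbessel_coef; rewrite pow_add, pow_mult; ring.
Qed.

(** Since [(n+k)! >= n!], the series is dominated by that of [exp u] divided by [n!]. This crude
    bound serves only to make the energy remainder vanish in the limit. *)
Lemma Rabs_rbessel_le_exp (n : nat) (u : R) :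
  0 <= u -> Rabs (rbessel n u) <= exp u / INR (fact n).
Proof.
intros Hu.
assert (He := is_exp_Reals u).
apply is_pseries_R in He.
apply (is_series_scal_r (/ INR (fact n))) in He.
assert (Hle : forall k, Rabs (rbessel_coef n k * u ^ k)
                        <= / INR (fact k) * u ^ k * / INR (fact n)).
{ intros k; unfold rbessel_coef, Rdiv.
  pose proof (pow_le u k Hu).
  pose proof (INR_fact_lt_0 k); pose proof (INR_fact_lt_0 n).
  pose proof (INR_fact_lt_0 (n + k)).
  rewrite !Rabs_mult, Rabs_pow_m1, Rinv_mult, Rabs_mult, (Rabs_pos_eq (u ^ k))
    by assumption.
  rewrite !Rabs_pos_eq by (apply Rlt_le, Rinv_0_lt_compat; assumption).
  assert (/ INR (fact (n + k)) <= / INR (fact n))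
    by (apply Rinv_le_contravar; [|apply le_INR, fact_le]; auto; lia).
  assert (0 <= / INR (fact k) * u ^ k)
    by (apply Rmult_le_pos; [apply Rlt_le, Rinv_0_lt_compat|]; assumption).
  nra. }
unfold Rdiv; rewrite <- (is_series_unique _ _ He).
unfold rbessel, PSeries.
eapply Rle_trans.
- apply Series_Rabs.
  apply (ex_series_le (V := R_CompleteNormedModule)) with (2 := ex_intro _ _ He).
  intros k; unfold norm; simpl; unfold abs; simpl; rewrite Rabs_Rabsolu; apply Hle.
- apply Series_le; [|now eexists; apply He].
  intros k; split; [apply Rabs_pos|apply Hle].
Qed.

(** * The energy identity and the uniform bound by 1 *)

(* [hbessel n t] is [J_n (2 t)]. *)
Definition hbessel (n : nat) (t : R) : R := t ^ n * rbessel n (t ^ 2).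

Lemma is_derive_hbessel_0 (t : R) :
  is_derive (hbessel 0) t (- (2 * hbessel 1 t)).
Proof.
unfold hbessel; simpl pow.
pose proof (is_derive_rbessel 0 (t * (t * 1))) as H.
auto_derive; [eexists; exact H|].
change (fun x => rbessel 0 x) with (rbessel 0).
rewrite (is_derive_unique _ _ _ H); ring.
Qed.

Lemma is_derive_hbessel_S (n : nat) (t : R) :
  is_derive (hbessel (S n)) t (hbessel n t - hbessel (S (S n)) t).
Proof.
unfold hbessel.
pose proof (is_derive_rbessel (S n) (t ^ 2)) as H.
pose proof (rbessel_rec n (t ^ 2)) as E.
auto_derive; [eexists; simpl in H; exact H|].
change (fun x => rbessel (S n) x) with (rbessel (S n)).
replace (t * (t * 1)) with (t ^ 2) by ring.
rewrite (is_derive_unique _ _ _ H).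
(* Eliminating [j_n] by the recurrence leaves a polynomial identity in [t], [j_(n+1)] and
   [j_(n+2)]. *)
replace (rbessel n (t ^ 2)) with
  ((INR n + 1) * rbessel (S n) (t ^ 2) - t ^ 2 * rbessel (S (S n)) (t ^ 2))
  by (rewrite E; ring).
change (match n with O => 1 | S _ => INR n + 1 end) with (INR (S n)).
rewrite S_INR; simpl pow; ring.
Qed.

(** Partial sums of Neumann's series [J_0^2 + 2 (J_1^2 + J_2^2 + ...) = 1], at the argument [2t]. *)
Fixpoint hbessel_energy (N : nat) (t : R) : R :=
  match N with
  | 0 => hbessel 0 t ^ 2
  | S k => hbessel_energy k t + 2 * hbessel (S k) t ^ 2
  end.

(** The new square contributes [4 h_(N+1) (h_N - h_(N+2))], whose first half cancels the derivative
    at stage [N]. *)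
Lemma is_derive_hbessel_energy (N : nat) (t : R) :
  is_derive (hbessel_energy N) t (- (4 * (hbessel N t * hbessel (S N) t))).
Proof.
induction N as [|N IH].
- pose proof (is_derive_hbessel_0 t) as H.
  simpl; auto_derive; [repeat apply conj; trivial; eexists; eassumption|].
  change (fun x => hbessel 0 x) with (hbessel 0).
  rewrite (is_derive_unique _ _ _ H); ring.
- pose proof (is_derive_hbessel_S N t) as H.
  simpl; auto_derive; [repeat apply conj; trivial; eexists; eassumption|].
  change (fun x => hbessel (S N) x) with (hbessel (S N)).
  change (fun x => hbessel_energy N x) with (hbessel_energy N).
  rewrite (is_derive_unique _ _ _ H), (is_derive_unique _ _ _ IH); ring.
Qed.

Lemma hbessel_energy_0 (N : nat) : hbessel_energy N 0 = 1.
Proof.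
induction N as [|N IH]; simpl.
- unfold hbessel, rbessel; replace (0 ^ 2) with 0 by ring.
  rewrite PSeries_0; unfold rbessel_coef; simpl; field.
- rewrite IH; unfold hbessel; simpl; ring.
Qed.

Lemma hbessel_energy_pos (N : nat) (t : R) : 0 <= hbessel_energy N t.
Proof.
induction N as [|N IH]; simpl; [|pose proof (pow2_ge_0 (hbessel (S N) t))]; nra.
Qed.

Lemma hbessel_sqr_le_energy (n N : nat) (t : R) :
  (n <= N)%nat -> hbessel n t ^ 2 <= hbessel_energy N t.
Proof.
induction 1 as [|N _ IH].
- destruct n as [|n]; simpl hbessel_energy; [lra|].
  pose proof (hbessel_energy_pos n t); pose proof (pow2_ge_0 (hbessel (S n) t)).
  lra.
- simpl hbessel_energy; pose proof (pow2_ge_0 (hbessel (S N) t)); lra.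
Qed.

(** A bound uniform on [[0, T]], so that it applies at the unknown point given by the mean value
    theorem. *)
Lemma Rabs_hbessel_le_exp (n : nat) (t T : R) :
  0 <= t <= T -> Rabs (hbessel n t) <= exp (T ^ 2) * (/ INR (fact n) * T ^ n).
Proof.
intros Ht; unfold hbessel.
rewrite Rabs_mult, Rabs_pos_eq by (apply pow_le; lra).
replace (exp (T ^ 2) * (/ INR (fact n) * T ^ n))
  with (T ^ n * (exp (T ^ 2) / INR (fact n))) by (unfold Rdiv; ring).
apply Rmult_le_compat; [apply pow_le; lra|apply Rabs_pos|apply pow_incr; lra|].
eapply Rle_trans; [apply Rabs_rbessel_le_exp; nra|].
apply Rmult_le_compat_r; [apply Rlt_le, Rinv_0_lt_compat, INR_fact_lt_0|].
assert (t ^ 2 <= T ^ 2) by (apply pow_incr; lra).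
destruct (Req_dec (t ^ 2) (T ^ 2)) as [->|]; [lra|].
apply Rlt_le, exp_increasing; lra.
Qed.

(** Mean value theorem on [[0, T]]: the energy is 1 at 0, and both factors of its derivative are
    bounded uniformly. *)
Lemma hbessel_energy_le (N : nat) (T : R) :
  0 <= T ->
  hbessel_energy N T
    <= 1 + 4 * T * (exp (T ^ 2) * (/ INR (fact N) * T ^ N)
                    * (exp (T ^ 2) * (/ INR (fact (S N)) * T ^ S N))).
Proof.
intros HT.
destruct (MVT_gen (hbessel_energy N) 0 T
            (fun t => - (4 * (hbessel N t * hbessel (S N) t)))) as (c & Hc & E).
- intros t _; apply is_derive_hbessel_energy.
- intros t _; apply continuity_pt_filterlim, (ex_derive_continuous (hbessel_energy N)).
  eexists; apply is_derive_hbessel_energy.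
- rewrite Rmin_left, Rmax_right in Hc by exact HT.
  rewrite hbessel_energy_0 in E.
  pose proof (Rabs_hbessel_le_exp N c T Hc) as H1.
  pose proof (Rabs_hbessel_le_exp (S N) c T Hc) as H2.
  pose proof (Rmult_le_compat _ _ _ _ (Rabs_pos _) (Rabs_pos _) H1 H2) as H.
  rewrite <- Rabs_mult in H.
  set (B := exp (T ^ 2) * _ * _) in *.
  pose proof (Rle_abs (- (hbessel N c * hbessel (S N) c))) as H3.
  rewrite Rabs_Ropp in H3.
  nra.
Qed.

Lemma is_lim_seq_pow_fact (t : R) :
  is_lim_seq (fun n => / INR (fact n) * t ^ n) 0.
Proof.
apply ex_series_lim_0; eexists; apply is_pseries_R, is_exp_Reals.
Qed.

Lemma Rabs_hbessel_le_1 (n : nat) (t : R) : 0 <= t -> Rabs (hbessel n t) <= 1.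
Proof.
intros Ht.
assert (H : hbessel n t ^ 2 <= 1).
{ set (b := fun N => exp (t ^ 2) * (/ INR (fact N) * t ^ N)).
  assert (Hb : is_lim_seq b 0).
  { replace (Finite 0) with (Rbar_mult (exp (t ^ 2)) 0) by (simpl; f_equal; ring).
    apply is_lim_seq_scal_l, is_lim_seq_pow_fact. }
  (* The [n]-th square occurs in the energy only from [N = n] on, so the comparison is made
     eventually in [N]. *)
  apply (is_lim_seq_le_loc (fun _ => hbessel n t ^ 2)
           (fun N => 1 + 4 * t * (b N * b (S N))) (hbessel n t ^ 2) 1).
  - exists n; intros N HN; eapply Rle_trans.
    + now apply hbessel_sqr_le_energy with (N := N).
    + now apply hbessel_energy_le.
  - apply is_lim_seq_const.
  - replace (Finite 1) with (Finite (1 + 4 * t * (0 * 0))) by (f_equal; ring).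
    apply is_lim_seq_plus'; [apply is_lim_seq_const|].
    apply (is_lim_seq_scal_l _ (4 * t) (0 * 0)).
    apply is_lim_seq_mult'; [exact Hb|].
    now apply is_lim_seq_incr_1 in Hb. }
apply Rabs_le; nra.
Qed.

(** * The factorial bound on the reduced functions *)

Lemma is_derive_pow_rbessel (n : nat) (u : R) :
  is_derive (fun v => v ^ S n * rbessel (S n) v) u (u ^ n * rbessel n u).
Proof.
pose proof (is_derive_rbessel (S n) u) as H.
auto_derive; [eexists; exact H|].
change (fun x => rbessel (S n) x) with (rbessel (S n)).
rewrite (is_derive_unique _ _ _ H).
replace (rbessel n u) with
  ((INR n + 1) * rbessel (S n) u - u * rbessel (S (S n)) u)
  by (rewrite rbessel_rec; ring).
change (match n with O => 1 | S _ => INR n + 1 end) with (INR (S n)).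
rewrite S_INR; simpl pow; ring.
Qed.

Lemma Rabs_rbessel_le (n : nat) (u : R) :
  0 <= u -> Rabs (rbessel n u) <= / INR (fact n).
Proof.
revert u; induction n as [|n IH]; intros u Hu.
(* For [n = 0], [j_0(u)] is [J_0] at [2 sqrt u]. *)
{ pose proof (Rabs_hbessel_le_1 0 (sqrt u) (sqrt_pos u)) as H.
  unfold hbessel in H; rewrite pow2_sqrt, Rmult_1_l in H by exact Hu.
  simpl fact; rewrite INR_1, Rinv_1; exact H. }
(* At [u = 0] the value is exactly [1/(n+1)!]; it is treated apart because the final step cancels
   [u^(n+1)]. *)
destruct Hu as [Hu| <-].
2:{ unfold rbessel; rewrite PSeries_0; unfold rbessel_coef.
    replace (S n + 0)%nat with (S n) by lia.
    change (INR (fact 0)) with 1; simpl pow.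
    unfold Rdiv; rewrite !Rmult_1_l, Rabs_pos_eq; [lra|].
    apply Rlt_le, Rinv_0_lt_compat, INR_fact_lt_0. }
(* The integration step, once for each sign: the expression vanishes at 0 and has derivative
   [u^n (1/n! + s j_n(u))], nonnegative by the induction hypothesis. *)
assert (Hsign : forall s, s = 1 \/ s = -1 ->
          0 <= u ^ S n * (/ INR (fact (S n)) + s * rbessel (S n) u)).
{ intros s Hs.
  set (f := fun v => v ^ S n * / INR (fact (S n)) + s * (v ^ S n * rbessel (S n) v)).
  assert (D : forall v, is_derive f v (v ^ n * (/ INR (fact n) + s * rbessel n v))).
  { intros v; unfold f.
    pose proof (is_derive_pow_rbessel n v) as H.
    pose (g := fun v => v ^ S n * rbessel (S n) v).
    change (is_derive g v (v ^ n * rbessel n v)) in H.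
    change (is_derive (fun v => v ^ S n * / INR (fact (S n)) + s * g v) v
              (v ^ n * (/ INR (fact n) + s * rbessel n v))).
    rewrite INR_fact_S; pose proof (pos_INR n); pose proof (INR_fact_neq_0 n) as Hf.
    clear IH; generalize dependent (INR (fact n)); intros c Hf.
    auto_derive; [repeat apply conj; trivial; eexists; eassumption|].
    change (match n with O => 1 | S _ => INR n + 1 end) with (INR (S n)).
    change (fun x => g x) with g.
    rewrite (is_derive_unique _ _ _ H), S_INR; simpl pred.
    field; split; [exact Hf|lra]. }
  destruct (MVT_gen f 0 u (fun v => v ^ n * (/ INR (fact n) + s * rbessel n v)))
    as (c & Hc & E).
  - intros v _; apply D.
  - intros v _; apply continuity_pt_filterlim, (ex_derive_continuous f).
    eexists; apply D.
  - rewrite Rmin_left, Rmax_right in Hc by lra.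
    assert (Hc0 := IH c (proj1 Hc)); apply Rabs_le_between in Hc0.
    assert (0 <= c ^ n) by (apply pow_le; lra).
    assert (0 <= / INR (fact n) + s * rbessel n c) by (destruct Hs as [-> | ->]; lra).
    assert (Hf0 : f 0 = 0) by (unfold f; rewrite pow_ne_zero by easy; ring).
    assert (0 <= f u)
      by (replace (f u) with (f u - f 0) by lra; rewrite E;
          repeat apply Rmult_le_pos; lra).
    unfold f in *; lra. }
assert (Hpos : 0 < u ^ S n) by (now apply pow_lt).
apply Rabs_le; split.
- assert (H := Hsign 1 (or_introl eq_refl)); nra.
- assert (H := Hsign (-1) (or_intror eq_refl)); nra.
Qed.

(** * Bounds on [J_n] and on the terms of Graf's series *)

Lemma Rabs_BesselJ (n : Z) (x : R) :
  Rabs (BesselJ n x) = Rabs (BesselJ_nat (Z.abs_nat n) x).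
Proof.
unfold BesselJ; destruct (n <? 0)%Z; [|easy].
now rewrite Rabs_mult, Rabs_pow_m1, Rmult_1_l.
Qed.

Lemma Rabs_BesselJ_le_1 (n : Z) (x : R) : 0 <= x -> Rabs (BesselJ n x) <= 1.
Proof.
intros Hx; rewrite Rabs_BesselJ, BesselJ_nat_rbessel.
apply Rabs_hbessel_le_1; lra.
Qed.

Lemma Rabs_BesselJ_le_pow (n : Z) (x : R) :
  0 <= x ->
  Rabs (BesselJ n x) <= (x / 2) ^ Z.abs_nat n / INR (fact (Z.abs_nat n)).
Proof.
intros Hx; rewrite Rabs_BesselJ, BesselJ_nat_rbessel.
rewrite Rabs_mult, Rabs_pos_eq by (apply pow_le; lra).
apply Rmult_le_compat_l; [apply pow_le; lra|].
apply Rabs_rbessel_le; nra.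
Qed.

(** With [q = p+1+k], passing to the next term multiplies by [(x/2)/(q+1)], which is at most [1/2]
    because [x <= p <= q]. This is where the hypothesis [|y| <= p] enters. *)
Lemma pow_fact_le_geom (p k : nat) (x : R) :
  0 <= x <= INR p ->
  (x / 2) ^ (p + 1 + k) / INR (fact (p + 1 + k))
    <= (x / 2) ^ (p + 1) / INR (fact (p + 1)) * (1 / 2) ^ k.
Proof.
intros Hx; induction k as [|k IH].
{ rewrite Nat.add_0_r; simpl; lra. }
replace (p + 1 + S k)%nat with (S (p + 1 + k)) by lia.
set (q := (p + 1 + k)%nat) in *.
assert (Hq : INR p <= INR q) by (apply le_INR; unfold q; lia).
rewrite INR_fact_S.
pose proof (INR_fact_lt_0 q) as Hf.
replace ((x / 2) ^ S q / ((INR q + 1) * INR (fact q)))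
  with ((x / 2) ^ q / INR (fact q) * (x / 2 / (INR q + 1))) by (simpl; field; lra).
replace ((x / 2) ^ (p + 1) / INR (fact (p + 1)) * (1 / 2) ^ S k)
  with ((x / 2) ^ (p + 1) / INR (fact (p + 1)) * (1 / 2) ^ k * (1 / 2))
  by (simpl; field; apply INR_fact_neq_0).
apply Rmult_le_compat; [| |exact IH|].
- apply Rdiv_le_0_compat; [apply pow_le|]; lra.
- apply Rdiv_le_0_compat; lra.
- apply Rle_div_l; lra.
Qed.

Lemma Cmod_cis (t : R) : Cmod (cis t) = 1.
Proof.
unfold Cmod, cis; simpl fst; simpl snd.
rewrite <- sqrt_1; f_equal.
pose proof (sin2_cos2 t) as H; unfold Rsqr in H; simpl; lra.
Qed.

(** The exponentials have modulus 1 and [|J_(m+n)(|x|)| <= 1], so the decay comes from [J_n(|y|)]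
    alone. *)
Lemma Cmod_graf_term_le (theta : R * R -> R) (s : R) (m n : Z) (x y : R * R) :
  Cmod (graf_term theta s m x y n)
    <= (vnorm y / 2) ^ Z.abs_nat n / INR (fact (Z.abs_nat n)).
Proof.
unfold graf_term; rewrite !Cmod_mult, !Cmod_cis, !Cmod_R, !Rmult_1_r.
rewrite <- (Rmult_1_l (_ / _)).
apply Rmult_le_compat; try apply Rabs_pos.
- apply Rabs_BesselJ_le_1, sqrt_pos.
- apply Rabs_BesselJ_le_pow, sqrt_pos.
Qed.

(** * The modulus of a dominated complex series *)

(* With [L = CSeries a], Cauchy-Schwarz bounds the terms of
   [|L|^2 = sum_n (Re L Re a_n + Im L Im a_n)] by [|L| b_n]. *)
Lemma Cmod_CSeries_le (a : nat -> C) (b : nat -> R) :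
  (forall n, Cmod (a n) <= b n) -> ex_series b -> Cmod (CSeries a) <= Series b.
Proof.
intros Hab Hb.
assert (Hfst : ex_series (fun n => fst (a n))).
{ apply (ex_series_le (V := R_CompleteNormedModule)) with (2 := Hb).
  intros n; apply Rle_trans with (2 := Hab n).
  eapply Rle_trans; [apply Rmax_l|apply Rmax_Cmod]. }
assert (Hsnd : ex_series (fun n => snd (a n))).
{ apply (ex_series_le (V := R_CompleteNormedModule)) with (2 := Hb).
  intros n; apply Rle_trans with (2 := Hab n).
  eapply Rle_trans; [apply Rmax_r|apply Rmax_Cmod]. }
assert (Hb0 : forall n, 0 <= b n)
  by (intros n; apply Rle_trans with (2 := Hab n), Cmod_ge_0).
set (L := CSeries a).
assert (Hsq : forall z : C, Cmod z * Cmod z = fst z ^ 2 + snd z ^ 2).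
{ intros z; apply sqrt_sqrt.
  pose proof (pow2_ge_0 (fst z)); pose proof (pow2_ge_0 (snd z)); lra. }
assert (Hcs : forall n, fst L * fst (a n) + snd L * snd (a n) <= Cmod L * b n).
{ intros n.
  apply Rle_trans with (Cmod L * Cmod (a n));
    [|apply Rmult_le_compat_l; [apply Cmod_ge_0|apply Hab]].
  pose proof (Hsq L); pose proof (Hsq (a n)).
  pose proof (Rmult_le_pos _ _ (Cmod_ge_0 L) (Cmod_ge_0 (a n))) as H1.
  apply Rnot_lt_le; intros H2.
  assert (H3 : (Cmod L * Cmod (a n)) * (Cmod L * Cmod (a n))
               < (fst L * fst (a n) + snd L * snd (a n)) ^ 2) by nra.
  replace ((Cmod L * Cmod (a n)) * (Cmod L * Cmod (a n)))
    with ((fst L ^ 2 + snd L ^ 2) * (fst (a n) ^ 2 + snd (a n) ^ 2)) in H3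
    by (rewrite <- !Hsq; ring).
  (* By Lagrange's identity this square is the difference of the two sides of [H3], which
     contradicts the strict inequality. *)
  pose proof (pow2_ge_0 (fst L * snd (a n) - snd L * fst (a n))).
  nra. }
assert (Hmain : Cmod L * Cmod L <= Cmod L * Series b).
{ rewrite Hsq.
  replace (fst L ^ 2 + snd L ^ 2)
    with (Series (fun n => fst L * fst (a n) + snd L * snd (a n))).
  2:{ rewrite Series_plus, !Series_scal_l;
        [unfold L, CSeries; simpl; ring| |];
        now apply (ex_series_scal_l (V := R_NormedModule)). }
  rewrite <- Series_scal_l.
  apply Rminus_le_0; rewrite <- Series_minus.
  - replace 0 with (Series (fun _ => 0 * 0)) by (rewrite Series_scal_l; ring).
    apply Series_le.
    + intros n; specialize (Hcs n); lra.
    + apply (ex_series_minus (V := R_NormedModule));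
        [|apply (ex_series_plus (V := R_NormedModule))];
        now apply (ex_series_scal_l (V := R_NormedModule)).
  - now apply (ex_series_scal_l (V := R_NormedModule)).
  - apply (ex_series_plus (V := R_NormedModule));
      now apply (ex_series_scal_l (V := R_NormedModule)). }
(* If [|L| > 0], divide by it; if [|L| = 0], the claim is that a series of nonnegative terms has
   nonnegative sum. *)
destruct (Cmod_ge_0 L) as [HL|HL].
- now apply Rmult_le_reg_l with (1 := HL).
- rewrite <- HL.
  replace 0 with (Series (fun _ => 0 * 0)) by (rewrite Series_scal_l; ring).
  apply Series_le; [|exact Hb].
  intros n; specialize (Hb0 n); lra.
Qed.

(** * Euler's integral at positive integers *)

Lemma is_lim_pow_exp_opp (n : nat) :
  is_lim (fun t => t ^ n * exp (- t)) p_infty 0.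
Proof.
apply (is_lim_le_le_loc (fun _ => 0) (fun t => INR (fact (S n)) * / t)).
- exists 0; intros t Ht.
  assert (He := exp_pos (- t)).
  assert (Htn : 0 < t ^ n) by (now apply pow_lt).
  split; [nra|].
  (* A single Taylor term of [exp t] suffices: it gives [t^n exp(-t) <= (n+1)!/t]. *)
  assert (H : t ^ S n / INR (fact (S n)) <= exp t).
  { apply Rle_trans with (2 := exp_ge_taylor t (S n) (Rlt_le _ _ Ht)).
    rewrite tech5, <- (Rplus_0_l (_ / _)) at 1; apply Rplus_le_compat_r.
    apply cond_pos_sum; intros k.
    apply Rdiv_le_0_compat; [apply pow_le; lra|apply INR_fact_lt_0]. }
  apply Rle_div_l in H; [|apply INR_fact_lt_0].
  apply (Rmult_le_compat_r (exp (- t))) in H; [|lra].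
  replace (exp t * INR (fact (S n)) * exp (- t)) with (INR (fact (S n))) in H
    by (rewrite exp_Ropp; field; pose proof (exp_pos t); lra).
  apply (proj1 (Rle_div_r _ _ t Ht)).
  simpl pow in H; lra.
- apply is_lim_const.
- replace (Finite 0) with (Rbar_mult (INR (fact (S n))) (Rbar_inv p_infty))
    by (simpl; f_equal; ring).
  apply is_lim_scal_l, is_lim_inv; [apply is_lim_id|easy].
Qed.

(** The primitive of [t^n exp(-t)] that vanishes at infinity, unfolded by integration by parts; it
    is minus the upper incomplete Gamma function at [n+1]. *)
Fixpoint Gamma_primitive (n : nat) (t : R) : R :=
  match n with
  | 0 => - exp (- t)
  | S k => INR (S k) * Gamma_primitive k t - t ^ S k * exp (- t)
  end.

Lemma is_derive_Gamma_primitive (n : nat) (t : R) :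
  is_derive (Gamma_primitive n) t (t ^ n * exp (- t)).
Proof.
induction n as [|n IH].
- simpl; auto_derive; [easy|ring].
- change (is_derive (fun t => INR (S n) * Gamma_primitive n t - t ^ S n * exp (- t))
            t (t ^ S n * exp (- t))).
  auto_derive; [repeat apply conj; trivial; eexists; eassumption|].
  change (match n with O => 1 | S _ => INR n + 1 end) with (INR (S n)).
  change (fun x => Gamma_primitive n x) with (Gamma_primitive n).
  rewrite (is_derive_unique _ _ _ IH); simpl pred; simpl pow; ring.
Qed.

Lemma Gamma_primitive_0 (n : nat) : Gamma_primitive n 0 = - INR (fact n).
Proof.
induction n as [|n IH].
- simpl; now rewrite Ropp_0, exp_0.
- simpl Gamma_primitive; rewrite IH, INR_fact_S.
  change (match n with O => 1 | S _ => INR n + 1 end) with (INR (S n)).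
  rewrite S_INR; ring.
Qed.

Lemma is_lim_Gamma_primitive (n : nat) : is_lim (Gamma_primitive n) p_infty 0.
Proof.
induction n as [|n IH].
- apply (is_lim_ext (fun t => - (t ^ 0 * exp (- t)))); [intros t; simpl; ring|].
  replace (Finite 0) with (Rbar_opp 0) by (simpl; f_equal; ring).
  apply is_lim_opp, is_lim_pow_exp_opp.
- change (is_lim (fun t => INR (S n) * Gamma_primitive n t - t ^ S n * exp (- t))
            p_infty 0).
  replace (Finite 0) with (Finite (INR (S n) * 0 - 0)) by (f_equal; ring).
  apply is_lim_minus'; [|apply is_lim_pow_exp_opp].
  exact (is_lim_scal_l _ (INR (S n)) _ _ IH).
Qed.

Lemma Gamma_fact (n : nat) : Gamma (INR n + 1) = INR (fact n).
Proof.
apply is_RInt_gen_unique.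
assert (HD : forall t, Derive (Gamma_primitive n) t = t ^ n * exp (- t))
  by (intros t; apply is_derive_unique, is_derive_Gamma_primitive).
apply is_RInt_gen_ext with (f := Derive (Gamma_primitive n)).
(* With both endpoints positive, every [t] between them is positive, and there the real power
   [Rpower t n] agrees with [t ^ n]. *)
- apply Filter_prod with (fun a => 0 < a) (fun b => 0 < b).
  + now exists (mkposreal 1 Rlt_0_1).
  + now exists 0.
  + intros a b Ha Hb t [Ht _]; simpl in Ht.
    assert (0 < t) by (apply Rlt_trans with (2 := Ht); now apply Rmin_glb_lt).
    rewrite HD; replace (INR n + 1 - 1) with (INR n) by ring.
    now rewrite Rpower_pow.
- replace (INR (fact n)) with (0 - Gamma_primitive n 0)
    by (rewrite Gamma_primitive_0; ring).
  apply is_RInt_gen_Derive.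
  + apply filter_forall; intros ab t _; eexists; apply is_derive_Gamma_primitive.
  + apply filter_forall; intros ab t _.
    apply continuous_ext with (fun t => t ^ n * exp (- t)); [easy|].
    apply (ex_derive_continuous (fun t => t ^ n * exp (- t))); now auto_derive.
  (* The primitive is continuous at 0, so its limit from the right is its value there. *)
  + apply (filterlim_filter_le_1 (F := locally 0) _ (filter_le_within _)).
    apply (ex_derive_continuous (Gamma_primitive n)).
    eexists; apply is_derive_Gamma_primitive.
  + apply is_lim_Gamma_primitive.
Qed.

(** * The truncation bound *)

Theorem theorem1 (theta : R * R -> R)
    (Htheta : forall v : R * R, is_polar_angle v (theta v))
    (s : R) (Hs : s = 1 \/ s = -1)
    (m p : nat) (x y : R * R) (Hp : vnorm y <= INR p) :
  Cmod (RJ theta s (Z.of_nat m) p x y)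
    <= 4 / Gamma (INR p + 2) * (vnorm y / 2) ^ (p + 1).
Proof.
assert (Hy : 0 <= vnorm y) by apply sqrt_pos.
replace (INR p + 2) with (INR (p + 1) + 1) by (rewrite plus_INR; simpl; ring).
rewrite Gamma_fact.
set (c := (vnorm y / 2) ^ (p + 1) / INR (fact (p + 1))).
assert (Hhalf : Rabs (1 / 2) < 1) by (rewrite Rabs_pos_eq; lra).
(* The bound depends only on [|n k|], so one statement covers both tails, [n k = p+1+k] and
   [n k = -(p+1+k)]. The factor 2 is the sum of the geometric series of ratio [1/2]. *)
assert (Htail : forall n : nat -> Z,
          (forall k, Z.abs_nat (n k) = (p + 1 + k)%nat) ->
          Cmod (CSeries (fun k => graf_term theta s (Z.of_nat m) x y (n k))) <= c * 2).
{ intros n Hn.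
  replace 2 with (Series (fun k => (1 / 2) ^ k)) by (rewrite Series_geom; lra).
  rewrite <- Series_scal_l; apply Cmod_CSeries_le.
  - intros k; eapply Rle_trans; [apply Cmod_graf_term_le|].
    rewrite Hn; now apply pow_fact_le_geom.
  - apply (ex_series_scal_l (V := R_NormedModule)), ex_series_geom, Hhalf. }
(* The constant 4 is 2 for each of the two tails. *)
replace (4 / INR (fact (p + 1)) * (vnorm y / 2) ^ (p + 1)) with (c * 2 + c * 2)
  by (unfold c; field; apply INR_fact_neq_0).
eapply Rle_trans; [apply Cmod_triangle|].
apply Rplus_le_compat; apply Htail; intros k; lia.
Qed.
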